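(* Let $\mathcal{M}$ be a smooth manifold with Riemannian metric $g$, let $\nabla$ be an affine connection on $\mathcal{M}$ and let $\nabla^{\star}$ be its torsion dual. Then: (i) if the connections $\nabla$ and $\nabla^{\star}$ are metric ($\nabla g=0$ and $\nabla^{\star}g=0$), then the mean connection $\tfrac12(\nabla+\nabla^{\star})$ is the Levi-Civita connection of $g$; (ii) $(\nabla^{\star})^{\star}=\nabla$.
   Context: All objects are smooth. Torsion dual: the torsion dual connection $\nabla^{\star}$ of an affine connection $\nabla$ is the affine connection defined by $\nabla_XY-\nabla^{\star}_YX-[X,Y]=0$ for all smooth vector fields $X,Y$ on $\mathcal{M}$. With connection coefficients defined by $\nabla_{\partial_i}\partial_j=\Gamma^{k}{}_{ji}\partial_k$, this reads $\Gamma^{\star\, i}{}_{kj}=\Gamma^{i}{}_{jk}$ in local coordinates. The mean connection is $\big(\tfrac12(\nabla+\nabla^{\star})\big)_XY=\tfrac12(\nabla_XY+\nabla^{\star}_XY)$. *)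

(* Defs.v *)
From HB Require Import structures.
From mathcomp Require Import all_boot all_order all_algebra.
From mathcomp Require Import all_classical all_reals all_analysis.
From mathcomp Require Import ring lra.
Set Implicit Arguments.
Unset Strict Implicit.
Unset Printing Implicit Defensive.
Import Order.TTheory GRing.Theory Num.Theory.
Import numFieldNormedType.Exports.
Local Open Scope classical_set_scope.
Local Open Scope ring_scope.

Section Smooth.
Variables (R : realType) (n : nat).
Implicit Types (U : set 'rV[R]_n) (f g : 'rV[R]_n -> R).

(* [f] has continuous partial derivatives of all orders at most [k] on the
   open set [U]; its values outside [U] are irrelevant. *)
Fixpoint Ck (k : nat) U f : Prop :=
  (forall x, U x -> {for x, continuous f}) /\
  (if k is k'.+1 then
     forall i : 'I_n, (forall x, U x -> derivable f x (delta_mx 0 i)) /\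
                      Ck k' U ('D_(delta_mx 0 i) f)
   else True).

Definition smooth_on U f : Prop := forall k, Ck k U f.

Lemma CkS k U f : Ck k.+1 U f -> Ck k U f.
Proof.
elim: k f => [|k IH] f [cf df]; first by [].
by split=> // i; have [dfi Cf] := df i; split=> //; apply: IH.
Qed.

Lemma Ck_eq k U f g : open U -> (forall x, U x -> f x = g x) ->
  Ck k U f -> Ck k U g.
Proof.
move=> oU.
have nearE (f' g' : 'rV[R]_n -> R) x : (forall x, U x -> f' x = g' x) -> U x ->
    \forall y \near x, f' y = g' y.
  by move=> fg Ux; apply: filterS fg _; exact: open_nbhs_nbhs.
have contE (f' g' : 'rV[R]_n -> R) : (forall x, U x -> f' x = g' x) ->
    (forall x, U x -> {for x, continuous f'}) ->
    forall x, U x -> {for x, continuous g'}.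
  move=> fg cf x Ux; rewrite /prop_for /continuous_at -fg//.
  by apply: cvg_trans (cf x Ux); exact: near_eq_cvg (nearE _ _ _ fg Ux).
elim: k f g => [|k IH] f g fg [cf df]; split=> //; try exact: contE fg cf.
move=> i; have [dfi Cf] := df i; split=> [x Ux|].
  by apply: near_eq_derivable (dfi x Ux); exact: nearE.
by apply: IH Cf => x Ux; apply: near_eq_derive; exact: nearE.
Qed.

Lemma Ck_cst k U (a : R) : Ck k U (cst a).
Proof.
elim: k a => [|k IH] a; split=> //; try by move=> x _; exact: cst_continuous.
move=> i; split=> [x _|]; first exact: derivable_cst.
suff -> : 'D_(delta_mx 0 i) (cst a : 'rV[R]_n -> R) = cst 0 by exact: IH.
by apply/funext => x; rewrite derive_cst.
Qed.

Lemma Ck_add k U f g : open U -> Ck k U f -> Ck k U g -> Ck k U (f + g).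
Proof.
move=> oU; elim: k f g => [|k IH] f g [cf df] [cg dg].
  by split=> // x Ux; exact: continuousD (cf x Ux) (cg x Ux).
split=> [x Ux|i]; first by exact: continuousD (cf x Ux) (cg x Ux).
have [dfi Cf] := df i; have [dgi Cg] := dg i; split=> [x Ux|].
  by apply: derivableD; [exact: dfi|exact: dgi].
apply: Ck_eq (IH _ _ Cf Cg) => // x Ux.
by rewrite deriveD; [|exact: dfi|exact: dgi].
Qed.

Lemma Ck_mul k U f g : open U -> Ck k U f -> Ck k U g -> Ck k U (f * g).
Proof.
move=> oU; elim: k f g => [|k IH] f g Hf Hg.
  case: Hf Hg => [cf df] [cg dg].
  by split=> // x Ux; exact: continuousM (cf x Ux) (cg x Ux).
have f1 := CkS Hf; have g1 := CkS Hg.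
case: Hf Hg => [cf df] [cg dg].
split=> [x Ux|i]; first by exact: continuousM (cf x Ux) (cg x Ux).
have [dfi Cf] := df i; have [dgi Cg] := dg i; split=> [x Ux|].
  by apply: derivableM; [exact: dfi|exact: dgi].
apply: Ck_eq (Ck_add oU (IH _ _ f1 Cg) (IH _ _ g1 Cf)) => // x Ux.
by rewrite deriveM; [|exact: dfi|exact: dgi].
Qed.

End Smooth.

(* [chart_inv] is a total function; only its values on the open set
   [chart_map @` chart_dom] matter. *)
Record chart (R : realType) (n : nat) (T : topologicalType) := Chart {
  chart_dom : set T;
  chart_map : T -> 'rV[R]_n;
  chart_inv : 'rV[R]_n -> T;
  chart_dom_open : open chart_dom;
  chart_codom_open : open (chart_map @` chart_dom);
  chart_mapK : forall p, chart_dom p -> chart_inv (chart_map p) = p;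
  chart_map_continuous : forall p, chart_dom p -> {for p, continuous chart_map};
  chart_inv_continuous : forall x, (chart_map @` chart_dom) x ->
    {for x, continuous chart_inv} }.

Definition chart_codom R n T (c : chart R n T) : set 'rV[R]_n :=
  chart_map c @` chart_dom c.

(* Quantified over all pairs of charts, this also makes the inverse
   transition maps smooth. *)
Definition chart_compatible R n T (c d : chart R n T) : Prop :=
  forall j : 'I_n,
    smooth_on (chart_map c @` (chart_dom c `&` chart_dom d))
              (fun x => chart_map d (chart_inv c x) 0 j).

(* The atlas need not be maximal: it determines the smooth structure. *)
Record smoothManifold (R : realType) (n : nat) := SmoothManifold {
  carrier :> topologicalType;
  carrier_hausdorff : hausdorff_space carrier;
  carrier_second_countable : @second_countable carrier;
  atlas : set (chart R n carrier);
  atlas_cover : forall p, exists2 c, atlas c & chart_dom c p;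
  atlas_compatible : forall c d, atlas c -> atlas d -> chart_compatible c d }.

Section SmoothFunctions.
Variables (R : realType) (n : nat) (M : smoothManifold R n).

Definition smooth (f : M -> R) : Prop :=
  forall c, atlas c -> smooth_on (chart_codom c) (f \o chart_inv c).

Lemma smooth_cst a : smooth (cst a).
Proof. by move=> c _ k; exact: Ck_cst. Qed.

Lemma smoothD f g : smooth f -> smooth g -> smooth (f + g).
Proof.
by move=> sf sg c Ac k; apply: Ck_add; [exact: chart_codom_open|exact: sf|exact: sg].
Qed.

Lemma smoothM f g : smooth f -> smooth g -> smooth (f * g).
Proof.
by move=> sf sg c Ac k; apply: Ck_mul; [exact: chart_codom_open|exact: sf|exact: sg].
Qed.

Lemma smoothZ a f : smooth f -> smooth (a *: f).
Proof.
move=> sf; have -> : a *: f = cst a * f by apply/funext.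
exact: smoothM (smooth_cst a) sf.
Qed.

Lemma smoothN f : smooth f -> smooth (- f).
Proof. by move=> sf; rewrite -scaleN1r; exact: smoothZ. Qed.

Lemma smoothB f g : smooth f -> smooth g -> smooth (f - g).
Proof. by move=> sf sg; apply: smoothD => //; exact: smoothN. Qed.

Definition smooth_pred : {pred M -> R} := fun f => `[< smooth f >].

Lemma smooth_subring_closed : subring_closed smooth_pred.
Proof.
split=> [|f g /asboolP sf /asboolP sg|f g /asboolP sf /asboolP sg];
  apply/asboolP.
- exact: smooth_cst.
- exact: smoothB.
- exact: smoothM.
Qed.

Lemma smooth_submod_closed : submod_closed smooth_pred.
Proof.
split=> [|a f g /asboolP sf /asboolP sg]; apply/asboolP.
  exact: smooth_cst.
by apply: smoothD => //; exact: smoothZ.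
Qed.

HB.instance Definition _ :=
  GRing.isSubringClosed.Build (M -> R) smooth_pred smooth_subring_closed.
HB.instance Definition _ :=
  GRing.isSubmodClosed.Build R (M -> R) smooth_pred smooth_submod_closed.

Record smooth_fun := SmoothFun {
  smooth_fun_val :> M -> R;
  _ : smooth_fun_val \in smooth_pred }.

HB.instance Definition _ := [isSub for smooth_fun_val].
HB.instance Definition _ := [Choice of smooth_fun by <:].
HB.instance Definition _ := 
  GRing.SubChoice_isSubComPzRing.Build _ _ smooth_fun smooth_subring_closed.
HB.instance Definition _ := [SubZmodule_isSubLmodule of smooth_fun by <:].

End SmoothFunctions.

Section SmoothFunctionsTheory.
Variables (R : realType) (n : nat) (M : smoothManifold R n).
Implicit Types f g : smooth_fun M.

Lemma smooth_funP f : smooth f.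
Proof. by apply/asboolP; exact: (valP f). Qed.

Lemma smooth_fun_ext f g : (forall p, f p = g p) -> f = g.
Proof. by move=> fg; apply: val_inj; apply/funext. Qed.

Definition mk_smooth (h : M -> R) (sh : smooth h) : smooth_fun M :=
  SmoothFun (asboolT sh : h \in @smooth_pred R n M).

Lemma sfunDE f g p : (f + g) p = f p + g p. Proof. by []. Qed.
Lemma sfunNE f p : (- f) p = - f p. Proof. by []. Qed.
Lemma sfunME f g p : (f * g) p = f p * g p. Proof. by []. Qed.
Lemma sfunZE (a : R) f p : (a *: f) p = a * f p. Proof. by []. Qed.
Lemma sfun1E p : (1 : smooth_fun M) p = 1. Proof. by []. Qed.
Lemma sfun0E p : (0 : smooth_fun M) p = 0. Proof. by []. Qed.

Definition sfunE := (sfunDE, sfunNE, sfunME, sfunZE, sfun1E, sfun0E).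

End SmoothFunctionsTheory.

Section TangentSpace.
Variables (R : realType) (n : nat) (M : smoothManifold R n) (p : M).

Definition derivation_at : {pred smooth_fun M -> R} := fun v =>
  `[< (forall a f g, v (a *: f + g) = a * v f + v g) /\
      (forall f g, v (f * g) = f p * v g + g p * v f) >].

Lemma derivation_at_submod_closed : submod_closed derivation_at.
Proof.
split=> [|a u v /asboolP[ul uL] /asboolP[vl vL]]; apply/asboolP; split.
- by move=> a f g; rewrite mulr0 addr0.
- by move=> f g; rewrite !mulr0 addr0.
- move=> b f g; change (a * u (b *: f + g) + v (b *: f + g) =
    b * (a * u f + v f) + (a * u g + v g)); rewrite ul vl; ring.
- move=> f g; change (a * u (f * g) + v (f * g) =
    f p * (a * u g + v g) + g p * (a * u f + v f)); rewrite uL vL; ring.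
Qed.

HB.instance Definition _ := GRing.isSubmodClosed.Build R (smooth_fun M -> R)
  derivation_at derivation_at_submod_closed.

(* Tangent vectors at [p]: derivations at [p] of the algebra C^oo(M). *)
Record tangent := Tangent {
  tangent_val :> smooth_fun M -> R;
  _ : tangent_val \in derivation_at }.

HB.instance Definition _ := [isSub for tangent_val].
HB.instance Definition _ := [Choice of tangent by <:].
HB.instance Definition _ := [SubChoice_isSubZmodule of tangent by <:].
HB.instance Definition _ := [SubZmodule_isSubLmodule of tangent by <:].

Lemma tangent_ext (u v : tangent) : (forall f, u f = v f) -> u = v.
Proof. by move=> uv; apply: val_inj; apply/funext. Qed.

Lemma tangent_linear (v : tangent) a f g : v (a *: f + g) = a * v f + v g.
Proof. by have /asboolP[+ _] := valP v; exact. Qed.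

Lemma tangent_leibniz (v : tangent) f g : v (f * g) = f p * v g + g p * v f.
Proof. by have /asboolP[_] := valP v; exact. Qed.

End TangentSpace.

Section VectorFields.
Variables (R : realType) (n : nat) (M : smoothManifold R n).
Implicit Types (f : smooth_fun M) (p : M).

Record vector_field := VectorField {
  vf_at :> forall p : M, tangent p;
  vf_smooth : forall f, smooth (fun p => vf_at p f) }.
Implicit Types X Y Z : vector_field.

Definition vf_app X f : smooth_fun M := mk_smooth (vf_smooth X f).

Lemma vf_ext X Y : (forall p f, X p f = Y p f) -> X = Y.
Proof.
case: X Y => [X sX] [Y sY] /= XY.
have eXY : X = Y.
  by apply: functional_extensionality_dep => p; apply: tangent_ext; exact: XY.
by move: sX sY; rewrite eXY => sX sY; congr VectorField; exact: Prop_irrelevance.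
Qed.

HB.instance Definition _ := gen_eqMixin vector_field.
HB.instance Definition _ := gen_choiceMixin vector_field.

Lemma vf_zero_smooth f : smooth (fun p => (0 : tangent p) f).
Proof. exact: smooth_cst. Qed.
Definition vf_zero := VectorField vf_zero_smooth.

Lemma vf_opp_smooth X f : smooth (fun p => (- X p) f).
Proof. exact: smoothN (vf_smooth X f). Qed.
Definition vf_opp X := VectorField (vf_opp_smooth X).

Lemma vf_add_smooth X Y f : smooth (fun p => (X p + Y p) f).
Proof. exact: smoothD (vf_smooth X f) (vf_smooth Y f). Qed.
Definition vf_add X Y := VectorField (vf_add_smooth X Y).

Lemma vf_addA : associative vf_add.
Proof. by move=> X Y Z; apply: vf_ext => p f; congr (tangent_val _ f); exact: addrA. Qed.
Lemma vf_addC : commutative vf_add.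
Proof. by move=> X Y; apply: vf_ext => p f; congr (tangent_val _ f); exact: addrC. Qed.
Lemma vf_add0 : left_id vf_zero vf_add.
Proof. by move=> X; apply: vf_ext => p f; congr (tangent_val _ f); exact: add0r. Qed.
Lemma vf_addN : left_inverse vf_zero vf_opp vf_add.
Proof. by move=> X; apply: vf_ext => p f; congr (tangent_val _ f); exact: addNr. Qed.

HB.instance Definition _ :=
  GRing.isZmodule.Build vector_field vf_addA vf_addC vf_add0 vf_addN.

Lemma vf_scale_smooth f X h : smooth (fun p => (f p *: X p) h).
Proof. exact: smoothM (smooth_funP f) (vf_smooth X h). Qed.
Definition vf_scale f X := VectorField (vf_scale_smooth f X).

Lemma vf_scaleA f g X : vf_scale f (vf_scale g X) = vf_scale (f * g) X.
Proof. by apply: vf_ext => p h; congr (tangent_val _ h); exact: scalerA. Qed.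
Lemma vf_scale1 : left_id 1 vf_scale.
Proof. by move=> X; apply: vf_ext => p h; congr (tangent_val _ h); exact: scale1r. Qed.
Lemma vf_scaleDr : right_distributive vf_scale +%R.
Proof.
by move=> f X Y; apply: vf_ext => p h; congr (tangent_val _ h); exact: scalerDr.
Qed.
Lemma vf_scaleDl X : {morph vf_scale^~ X : f g / f + g}.
Proof.
by move=> f g; apply: vf_ext => p h; congr (tangent_val _ h); exact: scalerDl.
Qed.

HB.instance Definition _ :=
  GRing.Zmodule_isLmodule.Build (smooth_fun M) vector_field
    vf_scaleA vf_scale1 vf_scaleDr vf_scaleDl.

Lemma vfDE X Y p f : (X + Y) p f = X p f + Y p f. Proof. by []. Qed.
Lemma vfNE X p f : (- X) p f = - X p f. Proof. by []. Qed.
Lemma vfZE f X p h : (f *: X) p h = f p * X p h. Proof. by []. Qed.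

Definition vfE := (vfDE, vfNE, vfZE).

Definition bracket_at X Y p : smooth_fun M -> R :=
  fun f => X p (vf_app Y f) - Y p (vf_app X f).

Lemma vf_app_linear X a f g : vf_app X (a *: f + g) = a *: vf_app X f + vf_app X g.
Proof. by apply: smooth_fun_ext => p; rewrite /= tangent_linear. Qed.

Lemma vf_app_leibniz X f g : vf_app X (f * g) = f * vf_app X g + g * vf_app X f.
Proof. by apply: smooth_fun_ext => p; rewrite /= tangent_leibniz. Qed.

Lemma tangentD p (v : tangent p) f g : v (f + g) = v f + v g.
Proof. by have := tangent_linear v 1 f g; rewrite scale1r mul1r. Qed.

Lemma bracket_derivation X Y p : bracket_at X Y p \in derivation_at p.
Proof.
apply/asboolP; split=> [a f g|f g]; rewrite /bracket_at.
  by rewrite !vf_app_linear !tangent_linear mulrBr opprD addrACA.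
rewrite !vf_app_leibniz !tangentD !tangent_leibniz /=; ring.
Qed.

Lemma bracket_smooth X Y f :
  smooth (fun p => Tangent (bracket_derivation X Y p) f).
Proof. exact: smoothB (vf_smooth X (vf_app Y f)) (vf_smooth Y (vf_app X f)). Qed.

Definition bracket X Y : vector_field := VectorField (bracket_smooth X Y).

Lemma bracketE X Y p f :
  bracket X Y p f = X p (vf_app Y f) - Y p (vf_app X f).
Proof. by []. Qed.

Definition const_fun (a : R) : smooth_fun M := mk_smooth (@smooth_cst R n M a).

End VectorFields.

(* By bump functions, [riem_smooth] for global vector fields is the
   smoothness of [g] as a tensor field. *)
Record riemannian_metric (R : realType) (n : nat) (M : smoothManifold R n) :=
  RiemannianMetric {
  riem_at :> forall p : M, tangent p -> tangent p -> R;
  riem_sym : forall p u v, @riem_at p u v = riem_at v u;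
  riem_linear : forall p (a : R) u v w,
    @riem_at p (a *: u + v) w = a * riem_at u w + riem_at v w;
  riem_pos : forall p u, u != 0 -> 0 < @riem_at p u u;
  riem_smooth : forall X Y : vector_field M,
    smooth (fun p => riem_at (X p) (Y p)) }.

Definition riem_app R n (M : smoothManifold R n) (g : riemannian_metric M)
    (X Y : vector_field M) : smooth_fun M := mk_smooth (riem_smooth g X Y).

(* [nabla X Y] is the covariant derivative of [Y] along [X].  Its R-linearity
   in [Y] is [conn_addr] together with [conn_leibniz] for constant [f]. *)
Record affine_connection (R : realType) (n : nat) (M : smoothManifold R n) :=
  AffineConnection {
  conn :> vector_field M -> vector_field M -> vector_field M;
  conn_linearl : forall (f : smooth_fun M) X X' Y,
    conn (f *: X + X') Y = f *: conn X Y + conn X' Y;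
  conn_addr : forall X Y Y', conn X (Y + Y') = conn X Y + conn X Y';
  conn_leibniz : forall X (f : smooth_fun M) Y,
    conn X (f *: Y) = f *: conn X Y + vf_app X f *: Y }.

Section Connections.
Variables (R : realType) (n : nat) (M : smoothManifold R n).
Implicit Types (X Y Z : vector_field M) (f : smooth_fun M).
Implicit Types (nabla : affine_connection M) (g : riemannian_metric M).

Lemma connection_ext nabla nabla' :
  (forall X Y, nabla X Y = nabla' X Y) -> nabla = nabla'.
Proof.
case: nabla nabla' => [c l a b] [c' l' a' b'] /= cc'.
have e : c = c' by apply/funext => X; apply/funext => Y.
move: l a b l' a' b'; rewrite e => l a b l' a' b'.
by congr AffineConnection; exact: Prop_irrelevance.
Qed.

Definition torsion nabla X Y := nabla X Y - nabla Y X - bracket X Y.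

Definition torsion_free nabla : Prop := forall X Y, torsion nabla X Y = 0.

(* (nabla_Z g)(X, Y) *)
Definition cov_deriv_metric g nabla Z X Y : smooth_fun M :=
  vf_app Z (riem_app g X Y)
  - riem_app g (nabla Z X) Y - riem_app g X (nabla Z Y).

Definition metric_connection g nabla : Prop :=
  forall Z X Y, cov_deriv_metric g nabla Z X Y = 0.

Definition is_levi_civita g nabla : Prop :=
  torsion_free nabla /\ metric_connection g nabla.

(* Solves nabla_Y X - nabla*_X Y - [Y, X] = 0 for nabla*; see
   [torsion_dualP]. *)
Definition torsion_dual_conn nabla X Y := nabla Y X + bracket X Y.

Lemma bracket_linearl f X X' Y :
  bracket (f *: X + X') Y =
  f *: bracket X Y + bracket X' Y - vf_app Y f *: X.
Proof.
apply: vf_ext => p h; rewrite !vfE !bracketE.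
have -> : vf_app (f *: X + X') h = f * vf_app X h + vf_app X' h.
  exact: smooth_fun_ext.
rewrite !vfE tangentD tangent_leibniz /=; ring.
Qed.

Lemma bracketC X Y : bracket X Y = - bracket Y X.
Proof. by apply: vf_ext => p h; rewrite !vfE !bracketE opprB. Qed.

Lemma torsion_dual_linearl nabla f X X' Y :
  torsion_dual_conn nabla (f *: X + X') Y =
  f *: torsion_dual_conn nabla X Y + torsion_dual_conn nabla X' Y.
Proof.
rewrite /torsion_dual_conn bracket_linearl conn_addr conn_leibniz scalerDr.
by apply: vf_ext => p h; rewrite !vfE; ring.
Qed.

Lemma torsion_dual_addr nabla X Y Y' :
  torsion_dual_conn nabla X (Y + Y') =
  torsion_dual_conn nabla X Y + torsion_dual_conn nabla X Y'.
Proof.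
rewrite /torsion_dual_conn -[Y in Y + Y']scale1r conn_linearl.
rewrite ![bracket X _]bracketC bracket_linearl.
have -> : vf_app X 1 = 0.
  apply: smooth_fun_ext => p /=; have := tangent_leibniz (X p) 1 1.
  rewrite mulr1 !sfunE !mul1r => /esym/eqP.
  by rewrite -subr_eq0 addrK => /eqP.
by rewrite scale0r subr0 !scale1r opprD addrACA.
Qed.

Lemma torsion_dual_leibniz nabla X f Y :
  torsion_dual_conn nabla X (f *: Y) =
  f *: torsion_dual_conn nabla X Y + vf_app X f *: Y.
Proof.
rewrite /torsion_dual_conn -[f *: Y]addr0 conn_linearl.
rewrite ![bracket X _]bracketC bracket_linearl.
have -> : nabla 0 X = 0.
  have := conn_linearl nabla 1 0 0 X; rewrite scaler0 addr0 scale1r => /esym/eqP.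
  by rewrite -subr_eq0 addrK => /eqP.
have -> : bracket 0 X = 0 :> vector_field M.
  apply: vf_ext => p h; rewrite bracketE sub0r.
  have -> : vf_app 0 h = 0 by exact: smooth_fun_ext.
  have := tangentD (X p) 0 0; rewrite addr0 => /esym/eqP.
  by rewrite -subr_eq0 addrK => /eqP ->; rewrite oppr0.
by apply: vf_ext => p h; rewrite !(vfE, scalerDr, addr0); ring.
Qed.

Definition torsion_dual nabla : affine_connection M :=
  AffineConnection (torsion_dual_linearl nabla) (torsion_dual_addr nabla)
    (torsion_dual_leibniz nabla).

Lemma torsion_dualP nabla nabla' :
  nabla' = torsion_dual nabla <->
  (forall X Y, nabla X Y - nabla' Y X - bracket X Y = 0).
Proof.
split=> [-> X Y|H].
  by rewrite /= /torsion_dual_conn [bracket Y X]bracketC subKr subrr.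
apply: connection_ext => X Y; rewrite /= /torsion_dual_conn.
have /eqP := H Y X; rewrite [bracket Y X]bracketC opprK addrAC subr_eq0.
by move=> /eqP <-.
Qed.

Definition mean_conn nabla nabla' X Y :=
  const_fun M 2^-1 *: (nabla X Y + nabla' X Y).

Lemma mean_linearl nabla nabla' f X X' Y :
  mean_conn nabla nabla' (f *: X + X') Y =
  f *: mean_conn nabla nabla' X Y + mean_conn nabla nabla' X' Y.
Proof.
rewrite /mean_conn !conn_linearl.
by apply: vf_ext => p h; rewrite !vfE; ring.
Qed.

Lemma mean_addr nabla nabla' X Y Y' :
  mean_conn nabla nabla' X (Y + Y') =
  mean_conn nabla nabla' X Y + mean_conn nabla nabla' X Y'.
Proof.
rewrite /mean_conn !conn_addr.
by apply: vf_ext => p h; rewrite !vfE; ring.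
Qed.

Lemma mean_leibniz nabla nabla' X f Y :
  mean_conn nabla nabla' X (f *: Y) =
  f *: mean_conn nabla nabla' X Y + vf_app X f *: Y.
Proof.
rewrite /mean_conn !conn_leibniz.
by apply: vf_ext => p h; rewrite !vfE /=; field.
Qed.

Definition mean_connection nabla nabla' : affine_connection M :=
  AffineConnection (mean_linearl nabla nabla') (mean_addr nabla nabla')
    (mean_leibniz nabla nabla').

Lemma levi_civita_unique g nabla nabla' :
  is_levi_civita g nabla -> is_levi_civita g nabla' -> nabla = nabla'.
Proof.
move=> [t m] [t' m'].
pose A X Y := nabla X Y - nabla' X Y.
pose S p X Y Z := g p (A X Y p) (Z p).
have AC X Y : A X Y = A Y X.
  have /eqP := t X Y; have /eqP := t' X Y.
  rewrite !subr_eq0 !subr_eq => /eqP e' /eqP e.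
  by rewrite /A e e' opprD addrACA subrr add0r.
have gB p (u v w : tangent p) : g p (u - v) w = g p u w - g p v w.
  by rewrite addrC -scaleN1r riem_linear mulN1r addrC.
have Santi p X Y Z : S p X Y Z = - S p X Z Y.
  have e := congr1 (fun f : smooth_fun M => f p) (m X Y Z).
  have e' := congr1 (fun f : smooth_fun M => f p) (m' X Y Z).
  move: e e'; rewrite /cov_deriv_metric !sfunE /=.
  rewrite [g p (Y p) _]riem_sym [g p (Y p) _]riem_sym.
  by rewrite /S /A !gB; lra.
have SC p X Y Z : S p X Y Z = S p Y X Z by rewrite /S AC.
apply: connection_ext => X Y; apply/eqP; rewrite -subr_eq0; apply/eqP.
apply: vf_ext => p f.
have S0 Z : S p X Y Z = 0.
  have : S p X Y Z = - S p X Y Z.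
    by rewrite {1}SC Santi SC Santi opprK SC Santi.
  by lra.
have [->//|A0] := eqVneq ((nabla X Y - nabla' X Y) p) 0.
by have := riem_pos g A0; rewrite -/(A X Y) [X in 0 < X]S0 ltxx.
Qed.

End Connections.

(* Main.v *)
Require Import Defs.
From mathcomp Require Import all_boot all_order all_algebra.
From mathcomp Require Import all_classical all_reals all_analysis.
From mathcomp Require Import ring.
Set Implicit Arguments.
Unset Strict Implicit.
Unset Printing Implicit Defensive.
Import GRing.Theory.
Local Open Scope ring_scope.

(** Torsion duality reverses the sign of the torsion, while both the torsion
    and the covariant derivative of [g] are affine functions of the connection
    (the bracket, resp. the derivative of [g(X, Y)], is the constant term), so
    each takes at a mean connection the mean of its two values.  The mean of a
    connection and its torsion dual thus has torsion [(T - T) / 2 = 0]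
    ([torsion_mean], [torsion_torsion_dual]), and it is metric as soon as both
    connections are ([cov_deriv_metric_mean]); these two properties
    characterize the Levi-Civita connection.  Duality is an involution
    ([torsion_dualK]) because the dual exchanges the two arguments and adds
    the bracket, which is antisymmetric. *)

Section TorsionDual.
Variables (R : realType) (n : nat) (M : smoothManifold R n).
Implicit Types (X Y Z : vector_field M) (g : riemannian_metric M).
Implicit Types nabla : affine_connection M.

Lemma riem_appDl g X Y Z :
  riem_app g (X + Y) Z = riem_app g X Z + riem_app g Y Z.
Proof.
apply: smooth_fun_ext => p; rewrite sfunDE /=.
have := riem_linear g 1 (X p) (Y p) (Z p).
by rewrite scale1r mul1r.
Qed.

Lemma riem_appZl g (f : smooth_fun M) X Z :
  riem_app g (f *: X) Z = f * riem_app g X Z.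
Proof.
apply: smooth_fun_ext => p; rewrite sfunME /=.
(* Linearity of [g] in the form [a *: u + v], at [a = -1] and [u = v], gives
   the value [0] at the zero vector. *)
have g0 : g p 0 (Z p) = 0.
  have := riem_linear g (-1) (X p) (X p) (Z p).
  by rewrite scaleN1r addNr mulN1r addNr.
have := riem_linear g (f p) (X p) 0 (Z p).
by rewrite addr0 g0 addr0.
Qed.

Lemma riem_appC g X Y : riem_app g X Y = riem_app g Y X.
Proof. by apply: smooth_fun_ext => p /=; exact: riem_sym. Qed.

(** The weights of the mean sum to [1], so the halved bracket terms add up to
    exactly the bracket that the torsion subtracts. *)
Lemma torsion_mean nabla nabla' X Y :
  torsion (mean_connection nabla nabla') X Y =
  const_fun M 2^-1 *: (torsion nabla X Y + torsion nabla' X Y).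
Proof.
rewrite /torsion /= /mean_conn.
by apply: vf_ext => p h; rewrite !vfE /=; field.
Qed.

Lemma torsion_torsion_dual nabla X Y :
  torsion (torsion_dual nabla) X Y = - torsion nabla X Y.
Proof.
rewrite /torsion /= /torsion_dual_conn [bracket Y X]bracketC.
by apply: vf_ext => p h; rewrite !vfE; ring.
Qed.

Lemma cov_deriv_metric_mean g nabla nabla' Z X Y :
  cov_deriv_metric g (mean_connection nabla nabla') Z X Y =
  const_fun M 2^-1 *
    (cov_deriv_metric g nabla Z X Y + cov_deriv_metric g nabla' Z X Y).
Proof.
rewrite /cov_deriv_metric /= /mean_conn.
rewrite ![riem_app g X _]riem_appC !riem_appZl !riem_appDl.
by apply: smooth_fun_ext => p; rewrite !sfunE /=; field.
Qed.

Lemma metric_mean_connection g nabla nabla' :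
  metric_connection g nabla -> metric_connection g nabla' ->
  metric_connection g (mean_connection nabla nabla').
Proof.
by move=> m m' Z X Y; rewrite cov_deriv_metric_mean m m' addr0 mulr0.
Qed.

Lemma torsion_free_mean_dual nabla :
  torsion_free (mean_connection nabla (torsion_dual nabla)).
Proof.
by move=> X Y; rewrite torsion_mean torsion_torsion_dual subrr scaler0.
Qed.

Lemma torsion_dualK nabla : torsion_dual (torsion_dual nabla) = nabla.
Proof.
apply: connection_ext => X Y; rewrite /= /torsion_dual_conn /=.
by rewrite /torsion_dual_conn [bracket Y X]bracketC subrK.
Qed.

End TorsionDual.

Theorem mainTheorem4 (R : realType) (n : nat) (M : smoothManifold R n)
    (g : riemannian_metric M) (nabla : affine_connection M) :
  (metric_connection g nabla -> metric_connection g (torsion_dual nabla) ->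
     is_levi_civita g (mean_connection nabla (torsion_dual nabla))) /\
  torsion_dual (torsion_dual nabla) = nabla.
Proof.
split; last exact: torsion_dualK.
move=> m m'; split; first exact: torsion_free_mean_dual.
exact: metric_mean_connection.
Qed.
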